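(* For any $0<\epsilon\leq 1/11$, every $d$-regular $\epsilon$-spectral expander on $2n$ vertices has at least $(d/e)^n\left(\frac{\epsilon}{2e^3d^6}\right)^{\epsilon n}$ perfect matchings.
   Context: For a graph $G$ on $2n$ vertices with adjacency matrix $A$ and diagonal degree matrix $D$, the normalized adjacency matrix is $\tilde A=D^{-1/2}AD^{-1/2}$, with eigenvalues $\lambda_1\geq\dots\geq\lambda_{2n}$; set $\sigma_2(\tilde A)=\max\{\lambda_2,|\lambda_{2n}|\}$. For $0<\epsilon<1$, $G$ is an $\epsilon$-spectral expander if $\sigma_2(\tilde A)\leq\epsilon$. *)

(* Defs.v *)
From HB Require Import structures.
From mathcomp Require Import all_boot all_order all_algebra.
From mathcomp Require Import reals sequences exp.
Set Implicit Arguments. Unset Strict Implicit. Unset Printing Implicit Defensive.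
Import Order.TTheory GRing.Theory Num.Theory.
Local Open Scope ring_scope.

Definition simple_graph (m : nat) (g : rel 'I_m) : Prop :=
  symmetric g /\ irreflexive g.

Definition degree (m : nat) (g : rel 'I_m) (i : 'I_m) : nat := #|[set j | g i j]|.

Definition regular (m : nat) (g : rel 'I_m) (d : nat) : Prop :=
  forall i, degree g i = d.

Definition adjacency (R : realType) (m : nat) (g : rel 'I_m) : 'M[R]_m :=
  \matrix_(i, j) (g i j)%:R.

Definition normalized_adjacency (R : realType) (m : nat) (g : rel 'I_m) : 'M[R]_m :=
  \matrix_(i, j) ((Num.sqrt (degree g i)%:R)^-1 * (adjacency R g) i j
                   * (Num.sqrt (degree g j)%:R)^-1).

Definition sorted_spectrum (R : realType) (m : nat) (M : 'M[R]_m) (s : seq R) : Prop :=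
  size s = m /\ sorted (>=%R) s /\
  char_poly M = \prod_(x <- s) ('X - x%:P).

Definition sigma2 (R : realType) (s : seq R) : R :=
  Num.max (nth 0 s 1) `|nth 0 s (size s).-1|.

Definition spectral_expander (R : realType) (m : nat) (g : rel 'I_m) (eps : R) : Prop :=
  exists s, sorted_spectrum (normalized_adjacency R g) s /\ sigma2 s <= eps.

Definition perfect_matching (m : nat) (g : rel 'I_m) (M : {set {set 'I_m}}) : bool :=
  [forall e in M, exists i, exists j, g i j && (e == [set i; j])] &&
  [forall v, #|[set e in M | v \in e]| == 1%N].

Definition num_perfect_matchings (m : nat) (g : rel 'I_m) : nat :=
  #|[set M : {set {set 'I_m}} | perfect_matching g M]|.

(* Main.v *)
Require Import Defs.
From HB Require Import structures.
From mathcomp Require Import all_boot all_order all_algebra.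
From mathcomp Require Import reals sequences exp.
From mathcomp Require Import complex zify ring lra.
Set Implicit Arguments. Unset Strict Implicit. Unset Printing Implicit Defensive.
Import Order.TTheory GRing.Theory Num.Theory.

(** Write [theta = eps * n] and [t] for its integer part, and let [N j] be the number of matchings
    leaving [2 j] vertices unmatched, so that [N n = 1] and [N 0] is wanted. By the expander mixing
    lemma the unmatched vertices of such a matching span at least [d j (j - theta) / n] edges when
    [j > theta], and adding any of them gives the ratio [N (j-1) / N j] the order it has in the
    count [(d/e)^n]. For [j <= t] no edge need be available, and augmenting paths are used instead:
    from two halves of the unmatched vertices two disjoint alternating forests are grown in
    parallel, and small sets expand so much that each layer can quadruple the forests (no blossom
    occurs because the two forests never meet). Once they have more than [eps * 2 n] even vertices
    each, mixing gives an edge between them. An augmenting path through [a] matching edges is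
    undone by choosing its end and [a] neighbours, which costs a factor [(d+1)^a], and the depths
    needed for [j = 1 .. t] sum to at most [2 t]. *)

(** * Matchings and alternating forests *)

(** Ordered pairs are counted, so for [X = Y] every edge of a symmetric [g] counts twice, as it does
    in [ends]. *)
Definition edges (V : finType) (g : rel V) (X Y : {set V}) : nat :=
  \sum_(v in Y) \sum_(u in X) g v u.

Definition nbrs (V : finType) (g : rel V) (X : {set V}) : {set V} :=
  [set v | [exists u in X, g v u]].

Section Matchings.
Variables (V : finType) (g : rel V).
Hypotheses (gsym : symmetric g) (girr : irreflexive g).

(** Matchings are encoded as involutions: fixed points are the unmatched vertices, the other orbits
    are the edges. *)
Definition matching (h : {ffun V -> V}) :=
  [forall v, (h (h v) == v) && ((h v == v) || g v (h v))].

Definition unmatched (h : {ffun V -> V}) := [set v | h v == v].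

Definition matchings (s : nat) := [set h | matching h & #|unmatched h| == s].

Lemma matchingP (h : {ffun V -> V}) :
  reflect ((forall v, h (h v) = v) /\ (forall v, h v != v -> g v (h v))) (matching h).
Proof.
apply: (iffP forallP) => [hm|[h1 h2] v]; last first.
  by rewrite h1 eqxx /=; case: eqP => //= /eqP /h2.
by split=> v; case/andP: (hm v) => /eqP // _ /orP[->|].
Qed.

Definition link (h : {ffun V -> V}) (x y : V) : {ffun V -> V} :=
  [ffun v => if v == x then y else if v == y then x else h v].

Definition ends (s : nat) : {set {ffun V -> V} * V * V} :=
  [set t | [&& t.1.1 \in matchings s, t.1.1 t.1.2 == t.1.2, t.1.1 t.2 == t.2
             & g t.1.2 t.2]].

Lemma card_dep_pairs (A B : finType) (S : {set A}) (F : A -> {set B}) :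
  #|[set p : A * B | (p.1 \in S) && (p.2 \in F p.1)]| = \sum_(a in S) #|F a|.
Proof.
rewrite -sum1dep_card (eq_bigr (fun a => \sum_(b in F a) 1)).
  by rewrite pair_big_dep.
by move=> a _; rewrite sum1_card.
Qed.

(** Linking [x] and [y] leaves [s] unmatched vertices, and the new matching together with its
    matched vertex [x] determines the triple: [y] is the new partner of [x], and [h] fixes both. *)
Lemma card_ends_le s : #|ends s.+2| <= #|matchings s| * (#|V| - s).
Proof.
pose phi (t : {ffun V -> V} * V * V) := (link t.1.1 t.1.2 t.2, t.1.2).
have phi_inj : {in ends s.+2 &, injective phi}.
  move=> [[h x] y] [[h' x'] y']; rewrite !inE /=.
  move=> /and4P[_ /eqP hx /eqP hy gxy] /and4P[_ /eqP hx' /eqP hy' gxy'].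
  move=> [/ffunP E xx]; subst x'.
  have yy : y = y' by have := E x; rewrite !ffunE eqxx.
  subst y'; congr (_, _, _); apply/ffunP => v.
  have := E v; rewrite !ffunE; case: eqP => [-> _|_]; first by rewrite hx hx'.
  by case: eqP => [-> _|_ //]; rewrite hy hy'.
rewrite -(card_in_imset phi_inj).
apply: (@leq_trans #|[set p : {ffun V -> V} * V |
    (p.1 \in matchings s) && (p.2 \in ~: unmatched p.1)]|).
  apply/subset_leq_card/subsetP => _ /imsetP[[[h x] y] + ->].
  rewrite !inE /= => /and4P[/andP[/matchingP[hh hg] /eqP hs] /eqP hx /eqP hy gxy].
  have xy : x != y by apply: contraTneq gxy => ->; rewrite girr.
  have hnx v : v != x -> h v != x by apply: contraNneq => E; rewrite -(hh v) E hx.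
  have hny v : v != y -> h v != y by apply: contraNneq => E; rewrite -(hh v) E hy.
  rewrite !ffunE eqxx [y == x]eq_sym (negPf xy) andbT.
  apply/andP; split.
    apply/matchingP; split=> v; rewrite !ffunE.
      case: (eqVneq v x) => [->|vx]; first by rewrite eq_sym (negPf xy) eqxx.
      case: (eqVneq v y) => [->|vy]; first by rewrite eqxx.
      by rewrite (negPf (hnx _ vx)) (negPf (hny _ vy)) hh.
    case: (eqVneq v x) => [->|vx] //; case: (eqVneq v y) => [->|vy]; last exact: hg.
    by rewrite gsym.
  have -> : unmatched (link h x y) = unmatched h :\ x :\ y.
    apply/setP => v; rewrite !inE ffunE.
    case: (eqVneq v x) => [->|vx] /=; first by rewrite andbF eq_sym (negPf xy).
    by case: (eqVneq v y) => [->|vy] //=; rewrite (negPf xy).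
  have := cardsD1 x (unmatched h); have := cardsD1 y (unmatched h :\ x).
  rewrite !inE hx hy !eqxx [y == x]eq_sym xy hs /= => -> /eqP.
  by rewrite eq_sym !add1n !eqSS.
rewrite (card_dep_pairs (matchings s) (fun h => ~: unmatched h)) -sum_nat_const.
apply: leq_sum => h; rewrite inE => /andP[_ /eqP hs].
by rewrite -hs -(cardsC (unmatched h)) addKn.
Qed.

Lemma card_ends s : #|ends s| = \sum_(h in matchings s) edges g (unmatched h) (unmatched h).
Proof.
pose F (h : {ffun V -> V}) := [set p : V * V | [&& h p.1 == p.1, h p.2 == p.2 & g p.1 p.2]].
have -> : ends s = [set ((p.1, p.2.1), p.2.2) | p in
    [set p : {ffun V -> V} * (V * V) | (p.1 \in matchings s) && (p.2 \in F p.1)]].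
  apply/setP => -[[h x] y]; apply/idP/imsetP.
    rewrite !inE /= => H; exists (h, (x, y)) => //.
    by rewrite !inE.
  by case=> -[h' [x' y']] /=; rewrite !inE /= => H [-> -> ->].
rewrite card_in_imset; last by move=> [a [b c]] [a' [b' c']] _ _ /= [-> -> ->].
rewrite card_dep_pairs; apply: eq_bigr => h _.
rewrite /edges -sum1dep_card.
transitivity (\sum_(v in unmatched h) \sum_(u in unmatched h | g v u) 1).
  rewrite pair_big_dep /=; apply: eq_bigl => -[v u] /=.
  by rewrite !inE.
by apply: eq_bigr => v _; rewrite big_mkcondr; apply: eq_bigr => u _; case: (g v u).
Qed.

(* The unmatched vertex [p] takes over the partner [w] of [h w], so that [h w] becomes unmatched. *)
Definition rot (h : {ffun V -> V}) (p w : V) : {ffun V -> V} :=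
  [ffun v => if v == p then w else if v == w then p else if v == h w then v else h v].

Section Rotation.
Variables (h : {ffun V -> V}) (p w : V).
Hypotheses (hm : matching h) (hp : h p = p) (hw : h w != w) (gpw : g p w).

Let hh v : h (h v) = v. Proof. by have [-> ] := matchingP _ hm. Qed.
Let pw : p != w. Proof. by apply: contraTneq gpw => ->; rewrite girr. Qed.
Let hwp : h w != p.
Proof. by apply: contraNneq pw => E; rewrite -(hh w) E hp. Qed.

Lemma rot_hole : rot h p w (h w) = h w.
Proof. by rewrite ffunE (negPf hwp) (negPf hw) eqxx. Qed.

Lemma rot_matching : matching (rot h p w).
Proof.
have [_ hg] := matchingP _ hm.
apply/matchingP; split=> v; rewrite !ffunE.
  case: (eqVneq v p) => [->|vp]; first by rewrite eq_sym (negPf pw) eqxx.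
  case: (eqVneq v w) => [->|vw]; first by rewrite eqxx.
  case: (eqVneq v (h w)) => [->|vhw]; first by rewrite (negPf hwp) (negPf hw) eqxx.
  have -> : (h v == p) = false by apply: contra_neqF vp => /eqP E; rewrite -(hh v) E hp.
  have -> : (h v == w) = false by apply: contra_neqF vhw => /eqP E; rewrite -(hh v) E.
  have -> : (h v == h w) = false.
    by apply: contra_neqF vw => /eqP E; rewrite -(hh v) E hh.
  by rewrite hh.
case: (eqVneq v p) => [->|vp] //; case: (eqVneq v w) => [->|vw]; first by rewrite gsym.
by case: (eqVneq v (h w)) => [->|vhw]; rewrite ?eqxx //; exact: hg.
Qed.

Lemma unmatched_rot : unmatched (rot h p w) = h w |: (unmatched h :\ p).
Proof.
apply/setP => v; rewrite !inE ffunE.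
case: (eqVneq v p) => [->|vp] /=.
  by rewrite eq_sym (negPf pw) orbF eq_sym (negPf hwp).
case: (eqVneq v w) => [->|vw].
  by rewrite (negPf pw) eq_sym (negPf hw).
by case: (eqVneq v (h w)) => [->|vhw]; rewrite ?eqxx.
Qed.

Lemma card_unmatched_rot : #|unmatched (rot h p w)| = #|unmatched h|.
Proof.
rewrite unmatched_rot cardsU1 !inE hh [w == _]eq_sym (negPf hw) andbF.
by rewrite [RHS](cardsD1 p) !inE hp eqxx.
Qed.

(** A rotation is reversed by rotating at the same [w] from the new unmatched vertex [h w]. As [w]
    is adjacent to [h w], a neighbour of the marked vertex suffices to name the predecessor. *)
Lemma rotK : rot (rot h p w) (h w) w = h.
Proof.
apply/ffunP => v; rewrite !ffunE eqxx [w == p]eq_sym (negPf pw).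
case: (eqVneq v (h w)) => [->|vhw]; first by rewrite hh.
case: (eqVneq v w) => [->|vw] //.
by case: (eqVneq v p) => [->|vp].
Qed.
End Rotation.

Definition state := ({ffun V -> V} * V)%type.

Fixpoint reach (k : nat) (s s' : state) : Prop :=
  if k is k'.+1 then
    reach k' s s' \/
    exists s0 w, [/\ reach k' s s0, matching s0.1, s0.1 s0.2 = s0.2,
      (s0.1 w != w) /\ g s0.2 w & s' = (rot s0.1 s0.2 w, s0.1 w)]
  else s = s'.

(** Candidates for predecessors under at most one rotation of the first marked vertex, the second
    being carried along. They need not be genuine predecessors, since only an upper bound on their
    number is wanted. *)
Definition back (E : {set {ffun V -> V} * V * V}) :=
  \bigcup_(t in E)
    (t |: [set (rot t.1.1 t.1.2 w, t.1.1 w, t.2) | w in [set w | g t.1.2 w]]).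

Lemma reach_back k (E : {set {ffun V -> V} * V * V}) s s' q :
  reach k s s' -> (s', q) \in E -> (s, q) \in iter k back E.
Proof.
elim: k E s' => [|k IH] E s'; first by move=> /= ->.
rewrite iterSr => -[/IH H|[[h p] [w [/IH H /= hm hp [hw gpw] ->]]]] sE.
  by apply: H; apply/bigcupP; exists (s', q); rewrite // setU11.
apply: H; apply/bigcupP; exists (rot h p w, h w, q) => //.
rewrite inE; apply/orP; right; apply/imsetP; exists w => /=.
  by rewrite inE gsym; have [_ hg] := matchingP _ hm; apply: hg.
by rewrite rotK // ffunE eqxx; congr (_, _, _); case: eqP.
Qed.

Lemma card_iter_back d k (E : {set {ffun V -> V} * V * V}) :
  (forall v, #|[set u | g v u]| = d) -> #|iter k back E| <= d.+1 ^ k * #|E|.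
Proof.
move=> greg; elim: k => [|k IH]; first by rewrite mul1n.
rewrite iterS expnS -mulnA; apply: leq_trans (leq_mul (leqnn d.+1) IH).
rewrite mulnC -sum_nat_const; set F := iter k back E.
apply: (@leq_trans (\sum_(t in F)
    #|t |: [set (rot t.1.1 t.1.2 w, t.1.1 w, t.2) | w in [set w | g t.1.2 w]]|)).
  rewrite /back; elim/big_rec2: _ => [|t m A _ mA]; first by rewrite cards0.
  by rewrite cardsU (leq_trans (leq_subr _ _)) // leq_add2l.
apply: leq_sum => t _; rewrite cardsU1 -(greg t.1.2) -add1n leq_add ?leq_b1 //.
exact: leq_imset_card.
Qed.

(** * Growing two disjoint alternating forests *)

Section Forest.
Variable f : {ffun V -> V}.
Hypothesis fm : matching f.

Let ff v : f (f v) = v. Proof. by have [-> ] := matchingP _ fm. Qed.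

(* [X] is a set of even vertices of an alternating forest of [f] with roots in [B], vertex set
   [D] and depth at most [k]. Quantifying over the matchings [h] that agree with [f] on [D] lets
   the rotations along two disjoint forests be composed. *)
Definition forest (k : nat) (D B X : {set V}) : Prop :=
  forall y, y \in X -> exists2 q, q \in B &
  forall h, matching h -> {in D, h =1 f} ->
  exists h', [/\ reach k (h, q) (h', y), matching h', h' y = y,
    #|unmatched h'| = #|unmatched h| & forall v, v \notin D -> h' v = h v].

Lemma forest0 (B : {set V}) : B \subset unmatched f -> forest 0 B B B.
Proof.
move=> /subsetP BU y yB; exists y => // h hm hf; exists h; split=> //.
by rewrite hf //; apply/eqP; have := BU y yB; rewrite inE.
Qed.

Definition fclosed_in (D : {set V}) := {in D, forall v, f v \in D}.

Lemma forest_grow k (D B X Z Y : {set V}) :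
  forest k D B X -> X \subset D -> D \subset Z -> unmatched f \subset Z -> fclosed_in Z ->
  Y \subset nbrs g X :\: Z ->
  forest k.+1 (D :|: (Y :|: f @: Y)) B (X :|: f @: Y).
Proof.
move=> DX /subsetP XD /subsetP DZ /subsetP UZ Zcl /subsetP YC.
have YP y : y \in Y -> [/\ y \notin D, f y != y & exists2 u, u \in X & g u y].
  move=> /YC; rewrite !inE => /andP[yZ /existsP[u /andP[uX gyu]]]; split.
  - by apply: contra yZ => /DZ.
  - by apply: contra yZ => /eqP E; apply: UZ; rewrite inE E.
  - by exists u; rewrite // gsym.
move=> y' /setUP[yX|/imsetP[y yY ->{y'}]].
  have [q qB H] := DX _ yX; exists q => // h hm hf.
  have [v vD|h' [h1 h2 h3 h4 h5]] := H h hm; first by apply: hf; rewrite inE vD.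
  exists h'; split=> //; first by left.
  by move=> v vD; apply: h5; apply: contra vD => vD; rewrite inE vD.
have [yD fy [u uX guy]] := YP y yY.
have [q qB H] := DX _ uX; exists q => // h hm hf.
have [v vD|h' [h1 h2 h3 h4 h5]] := H h hm; first by apply: hf; rewrite inE vD.
have h'y : h' y = f y by rewrite h5 // hf // !inE yY orbT.
have h'yy : h' y != y by rewrite h'y.
exists (rot h' u y); rewrite -h'y; split.
- by right; exists (h', u), y.
- exact: rot_matching.
- exact: rot_hole.
- by rewrite card_unmatched_rot.
- move=> v; rewrite !inE !negb_or => /and3P[vD vY vfY].
  rewrite ffunE h'y.
  have -> : (v == u) = false by apply: contraNF vD => /eqP ->; apply: XD.
  have -> : (v == y) = false by apply: contraNF vY => /eqP ->.
  have -> : (v == f y) = false by apply: contraNF vfY => /eqP ->; apply: imset_f.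
  exact: h5.
Qed.

(** Greedy choice: a chosen vertex excludes only itself and its partner. *)
Lemma half_transversal (C : {set V}) r :
  [disjoint C & unmatched f] -> r.*2 <= #|C| ->
  exists Y : {set V}, [/\ Y \subset C, #|Y| = r & [disjoint Y & f @: Y]].
Proof.
move=> CU; elim: r => [|r IH] rC.
  by exists set0; split; rewrite ?sub0set ?cards0 // -setI_eq0 set0I.
have [|Y [YC Yr Yd]] := IH; first by apply: leq_trans rC; rewrite doubleS; lia.
have [y yC yY] : exists2 y, y \in C & y \notin Y :|: f @: Y.
  apply/subsetPn; apply: contraL rC => /subset_leq_card H; rewrite -ltnNge.
  apply: leq_ltn_trans H _; apply: leq_ltn_trans (leq_card_setU _ _) _.
  rewrite doubleS ltnS ltnW // ltnS -addnn -[X in _ <= X + X]Yr leq_add2l.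
  exact: leq_imset_card.
move: yY; rewrite inE negb_or => /andP[yY yfY].
exists (y |: Y); split; first by rewrite subUset sub1set yC.
  by rewrite cardsU1 yY Yr.
have yfy : f y != y.
  apply/eqP => E; have := disjointFr CU yC; rewrite inE E eqxx //.
rewrite imsetU imset_set1 -setI_eq0; apply/eqP/setP => v; rewrite !inE.
apply/negbTE; rewrite negb_and.
case: (eqVneq v y) => [->|vy] /=.
  by rewrite negb_or eq_sym yfy.
case vY : (v \in Y) => //=; rewrite negb_or (disjointFr Yd vY) andbT.
apply: contra yfY => /eqP E; apply/imsetP; exists v => //; by rewrite E ff.
Qed.

Definition grown (k m : nat) (B D X : {set V}) :=
  [/\ #|X| = m, X \subset D, #|D| <= m.*2, fclosed_in D & forest k D B X].

(** [Z] stands for the vertices occupied by either forest. The new vertices are neighbours outside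
    [Z], and their partners are outside too because [Z] is closed under [f]; so the other forest is
    not met. *)
Lemma grown_step k m m' (B D X Z : {set V}) :
  grown k m B D X -> m <= m' -> D \subset Z -> unmatched f \subset Z -> fclosed_in Z ->
  #|Z| + (m' - m).*2 <= #|nbrs g X| ->
  exists D' X', [/\ grown k.+1 m' B D' X', D \subset D', #|D'| <= #|D| + (m' - m).*2 &
     [disjoint D' & Z :\: D]].
Proof.
move=> [Xm XD Dm Dcl DX] mm' DZ UZ Zcl le.
set C := nbrs g X :\: Z.
have CZ : [disjoint C & Z] by rewrite -setI_eq0 setIDAC setDIl setDv setI0.
have [||Y [YC Yr Yd]] := @half_transversal C (m' - m).
- by apply: disjointWr UZ CZ.
- have := cardsID Z (nbrs g X); have := subset_leq_card (subsetIr (nbrs g X) Z).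
  rewrite -/C; lia.
have YZ : [disjoint Y & Z] by apply: disjointWl YC CZ.
have fYZ : [disjoint f @: Y & Z].
  rewrite disjoints_subset; apply/subsetP => _ /imsetP[y yY ->]; rewrite inE.
  by apply: contraFN (disjointFr YZ yY) => /Zcl; rewrite ff.
have fYr : #|f @: Y| = m' - m by rewrite card_imset // => a b /(congr1 f); rewrite !ff.
exists (D :|: (Y :|: f @: Y)), (X :|: f @: Y).
have D'D : #|D :|: (Y :|: f @: Y)| <= #|D| + (m' - m).*2.
  apply: leq_trans (leq_card_setU _ _) _; rewrite leq_add2l.
  by apply: leq_trans (leq_card_setU _ _) _; rewrite Yr fYr addnn.
split=> //; last 2 first.
- exact: subsetUl.
- rewrite -setI_eq0 !setIUl !setU_eq0 !setI_eq0; apply/and3P; split.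
  + by rewrite -setI_eq0 setIDA setIC -setIDA setDv setI0.
  + by apply: disjointWr YZ; apply: subsetDl.
  + by apply: disjointWr fYZ; apply: subsetDl.
split.
- rewrite cardsU (_ : X :&: f @: Y = set0) ?cards0; last first.
    apply/eqP; rewrite setI_eq0 disjoint_sym; apply: disjointWr fYZ.
    exact: subset_trans XD DZ.
  rewrite Xm fYr; lia.
- by rewrite setUSS ?subsetUr.
- lia.
- move=> v /setUP[vD|/setUP[vY|/imsetP[y yY ->]]]; rewrite !inE.
  + by rewrite Dcl.
  + by rewrite imset_f ?orbT.
  + by rewrite ff yY orbT.
- exact: forest_grow DX XD DZ UZ Zcl YC.
Qed.

Definition grown2 (k m : nat) (B1 B2 : {set V}) := exists D1 X1 D2 X2,
  [/\ grown k m B1 D1 X1, grown k m B2 D2 X2, [disjoint D1 & D2]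
    & unmatched f \subset D1 :|: D2].

(** The forests are enlarged in turn. At the second enlargement the regions have at most [2 m'] and
    [2 m] vertices and [2 (m' - m)] more are taken, which adds up to the required [4 m']. *)
Lemma grown2_step k m m' (B1 B2 : {set V}) :
  grown2 k m B1 B2 -> m <= m' ->
  (forall X : {set V}, #|X| = m -> 4 * m' <= #|nbrs g X|) ->
  grown2 k.+1 m' B1 B2.
Proof.
move=> [D1 [X1 [D2 [X2 [G1 G2 D12 UD]]]]] mm' nX.
have clU D D' : fclosed_in D -> fclosed_in D' -> fclosed_in (D :|: D').
  by move=> c c' v; rewrite !inE => /orP[/c->//|/c'->]; rewrite orbT.
have [X1m X1D D1m D1c _] := G1; have [X2m X2D D2m D2c _] := G2.
have [|D1' [X1' [G1' DD1 D1'm D1'Z]]] := grown_step G1 mm' (subsetUl D1 D2) UD (clU _ _ D1c D2c).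
  have := (leq_card_setU D1 D2).1; have := nX X1 X1m; lia.
have D12' : [disjoint D1' & D2].
  apply: disjointWr D1'Z; apply/subsetP => v vD; rewrite !inE vD orbT andbT.
  by rewrite (disjointFl D12 vD).
have [_ _ D1m' D1c' _] := G1'.
have UD' : unmatched f \subset D1' :|: D2 by apply: subset_trans UD _; rewrite setSU.
have [|D2' [X2' [G2' DD2 D2'm D2'Z]]] := grown_step G2 mm' (subsetUr D1' D2) UD' (clU _ _ D1c' D2c).
  have := (leq_card_setU D1' D2).1; have := nX X2 X2m; lia.
exists D1', X1', D2', X2'; split=> //.
  rewrite disjoint_sym; apply: disjointWr D2'Z; apply/subsetP => v vD; rewrite !inE vD andbT.
  by rewrite (disjointFr D12' vD).
by apply: subset_trans UD' _; rewrite setUS.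
Qed.

Lemma grown2_iter j T (B1 B2 : {set V}) k :
  grown2 0 j B1 B2 -> j <= T ->
  (forall m m' (X : {set V}), #|X| = m -> m' <= 4 * m -> m' <= T -> 4 * m' <= #|nbrs g X|) ->
  grown2 k (minn (4 ^ k * j) T) B1 B2.
Proof.
move=> G jT nX; elim: k => [|k IH].
  by rewrite mul1n (minn_idPl jT).
apply: grown2_step IH _ _; first by rewrite expnS; lia.
by move=> X Xm; apply: nX Xm _ _; rewrite expnS; lia.
Qed.

Lemma grown2_base j (B1 B2 : {set V}) :
  #|B1| = j -> #|B2| = j -> [disjoint B1 & B2] -> unmatched f = B1 :|: B2 ->
  grown2 0 j B1 B2.
Proof.
move=> B1j B2j B12 U.
have base (B : {set V}) : #|B| = j -> B \subset unmatched f -> grown 0 j B B B.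
  move=> Bj BU; split=> //; first by rewrite Bj -addnn leq_addl.
    move=> v vB; have := subsetP BU v vB; rewrite inE => /eqP E; by rewrite E.
  exact: forest0.
exists B1, B1, B2, B2; split=> //.
- by apply: base; rewrite // U subsetUl.
- by apply: base; rewrite // U subsetUr.
- by rewrite U.
Qed.

Definition swap (t : {ffun V -> V} * V * V) := (t.1.1, t.2, t.1.2).

(** Contains each [(f, p, q)] that is led into [ends s] by at most [k] rotations from [p] followed
    by at most [k] from [q]. They are undone in reverse order, [swap] changing the end that
    moves. *)
Definition augmentable (k s : nat) := iter k back (swap @: iter k back (ends s)).

(** An edge joins even vertices [x] and [y] of the two forests. The rotations to [x] preserve [f] on
    [D2], so those to [y] can follow, and these leave [x] unmatched because it is outside [D2]. *)
Lemma grown2_augmentable k m s (B1 B2 : {set V}) :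
  f \in matchings s -> grown2 k m B1 B2 ->
  (forall X Y : {set V}, #|X| = m -> #|Y| = m -> 0 < edges g X Y) ->
  exists p q, [/\ p \in B1, q \in B2 & (f, p, q) \in augmentable k s].
Proof.
rewrite inE => /andP[_ /eqP fs] [D1 [X1 [D2 [X2 [[X1m X1D _ D1c F1] [X2m X2D _ D2c F2] D12 _]]]]].
move=> /(_ _ _ X1m X2m) e0.
have [y yX [x xX gyx]] : exists2 y, y \in X2 & exists2 x, x \in X1 & g y x.
  move: e0; rewrite lt0n sum_nat_eq0 negb_forall_in => /existsP[y /andP[yX]].
  rewrite sum_nat_eq0 negb_forall_in => /existsP[x /andP[xX]].
  by rewrite eqb0 negbK => gyx; exists y => //; exists x.
have [p pB H1] := F1 x xX; have [q qB H2] := F2 y yX.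
have [//|h1 [r1 m1 h1x c1 o1]] := H1 f fm.
have [|h2 [r2 m2 h2y c2 o2]] := H2 h1 m1.
  by move=> v vD; rewrite o1 // (disjointFl D12 vD).
exists p, q; split=> //; apply: (reach_back r1).
apply/imsetP; exists (h1, q, x) => //; apply: (reach_back r2).
rewrite !inE /= m2 c2 c1 fs h2y !eqxx gyx o2 ?h1x ?eqxx //.
by rewrite (disjointFr D12) // (subsetP X1D).
Qed.
End Forest.

Lemma augment_ratio d k j T :
  (forall v, #|[set u | g v u]| = d) -> 0 < j <= T -> T <= 4 ^ k * j ->
  (forall m m' (X : {set V}), #|X| = m -> m' <= 4 * m -> m' <= T -> 4 * m' <= #|nbrs g X|) ->
  (forall X Y : {set V}, #|X| = T -> #|Y| = T -> 0 < edges g X Y) ->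
  #|matchings j.*2| * j <= d.+1 ^ k.*2 * #|ends j.*2|.
Proof.
move=> greg /andP[j0 jT] Tk nX eX.
set G := augmentable k j.*2.
apply: (@leq_trans #|G|); last first.
  rewrite -addnn expnD -mulnA; apply: leq_trans (card_iter_back _ _ greg) _.
  rewrite leq_mul2l; apply/orP; right; apply: leq_trans (leq_imset_card _ _) _.
  exact: card_iter_back.
apply: leq_trans (leq_imset_card (fun t : {ffun V -> V} * V * V => t.1) G).
pose F (f : {ffun V -> V}) := [set p in unmatched f | [exists q, (f, p, q) \in G]].
apply: (@leq_trans #|[set p : {ffun V -> V} * V | (p.1 \in matchings j.*2) && (p.2 \in F p.1)]|).
  rewrite card_dep_pairs -sum_nat_const; apply: leq_sum => f fM.
  have := fM; rewrite inE => /andP[fm /eqP fu].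
  (* If fewer than [j] unmatched vertices started an augmentable triple, [j] of the others could
     root the first forest and the remaining [j] the second; the path found would start at one of
     those others. *)
  rewrite leqNgt; apply/negP => Fj.
  have /card_geqP[l [lu lsz lB]] : j <= #|unmatched f :\: F f|.
    have := cardsID (F f) (unmatched f).
    by have := subset_leq_card (subsetIr (unmatched f) (F f)); lia.
  pose B1 := [set x in l].
  have B1U : B1 \subset unmatched f :\: F f by apply/subsetP => x; rewrite inE => /lB.
  have B1U' : B1 \subset unmatched f by apply: subset_trans B1U (subsetDl _ _).
  have B1j : #|B1| = j by rewrite cardsE (card_uniqP lu).
  have G0 : grown2 f 0 j B1 (unmatched f :\: B1).
    apply: grown2_base => //.
    - by rewrite cardsD (setIidPr B1U') fu B1j -addnn addnK.
    - by rewrite disjoint_sym; apply/setDidPl; rewrite setDDl setUid.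
    - by rewrite -{1}(setID (unmatched f) B1) (setIidPr B1U').
  have G1 := grown2_iter fm k G0 jT nX; rewrite (minn_idPr Tk) in G1.
  have [p [q [pB _ pqG]]] := grown2_augmentable fm fM G1 eX.
  have := subsetP B1U p pB; rewrite !inE => /andP[+ pU]; rewrite pU /=.
  by case/existsP; exists q.
apply/subset_leq_card/subsetP => -[f p]; rewrite !inE /= => /andP[_ /andP[_ /existsP[q qG]]].
by apply/imsetP; exists (f, p, q).
Qed.
End Matchings.

(** * Total depth of the forests *)

(** For [j > 0] this is the least [a] with [T <= 4 ^ a * j]. As a sum of indicators it can be
    exchanged with a sum over [j]. *)
Definition depth (T j : nat) : nat := \sum_(0 <= k < T) (4 ^ k * j < T).

Lemma leq_depth T j : 0 < j -> T <= 4 ^ depth T j * j.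
Proof.
move=> j0; rewrite leqNgt; apply/negP; set a := depth T j => aT.
have aT' : a < T.
  by apply: leq_trans aT; rewrite ltnS (leq_trans (ltnW (ltn_expl a (isT : 1 < 4)))) ?leq_pmulr.
suff : a.+1 <= depth T j by rewrite ltnn.
rewrite /depth (big_cat_nat (n := a.+1)) //=; apply: leq_trans (leq_addr _ _).
rewrite (eq_big_nat _ _ (F2 := fun _ => 1)); first by rewrite sum_nat_const_nat subn0 muln1.
move=> k /andP[_ ka]; apply/eqP; rewrite eqb1; apply: leq_ltn_trans aT.
by rewrite leq_mul2r leq_exp2l // -ltnS ka orbT.
Qed.

Lemma sum_divn_exp x K : 3 * \sum_(0 <= k < K) x %/ 4 ^ k.+1 <= x.
Proof.
elim: K x => [|K IH] x; first by rewrite big_geq // muln0.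
rewrite big_nat_recl // expn1.
rewrite (eq_bigr (fun k => x %/ 4 %/ 4 ^ k.+1)); last by move=> k _; rewrite -divnMA -expnS.
by have := IH (x %/ 4); have := leq_divM x 4; lia.
Qed.

Lemma leq_double_exp4 m : 0 < m -> 2 * m.+1 <= 4 ^ m.
Proof. by elim: m => [//|[//|m] IH] _; rewrite expnS; have := IH isT; lia. Qed.

Lemma sum_leq_min t q : \sum_(1 <= j < t.+1) (j <= q) = minn t q.
Proof.
elim: t => [|t IH]; first by rewrite big_geq // min0n.
by rewrite big_nat_recr //= IH; lia.
Qed.

(** The indicators with [k = 0] contribute at most [t]. Those with [k > 0] contribute at most
    [(2 t + 1) / 4 ^ k] each time, in total a third of [2 t + 1], which rounds down to at most
    [t]. *)
Lemma sum_depth t : \sum_(1 <= j < t.+1) depth (2 * t).+2 j <= 2 * t.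
Proof.
rewrite /depth exchange_big_nat /= big_nat_recl //.
rewrite (eq_bigr (fun j => (j <= (2 * t).+1) : nat)); last by move=> j _; rewrite mul1n ltnS.
rewrite sum_leq_min.
apply: (@leq_trans (t + \sum_(0 <= k < (2 * t).+1) (2 * t).+1 %/ 4 ^ k.+1)).
  rewrite leq_add ?geq_minl //; apply: leq_sum => k _.
  rewrite (eq_bigr (fun j => (j <= (2 * t).+1 %/ 4 ^ k.+1) : nat)).
    by rewrite sum_leq_min geq_minr.
  by move=> j _; rewrite ltnS leq_divRL ?expn_gt0 // mulnC.
by have := sum_divn_exp (2 * t).+1 (2 * t).+1; lia.
Qed.

Local Open Scope ring_scope.

(** * The spectral gap and edge distribution *)

Lemma char_poly_similar (F : fieldType) n (P A B : 'M[F]_n) :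
  P \in unitmx -> P *m A = B *m P -> char_poly A = char_poly B.
Proof.
move=> Pu PA; have detP : (\det P)%:P != 0 :> {poly F}.
  by rewrite polyC_eq0 -unitfE -unitmxE.
apply: (mulfI detP); rewrite /char_poly -det_map_mx -[LHS]det_mulmx.
rewrite [RHS]mulrC -[RHS]det_mulmx /char_poly_mx mulmxBr mulmxBl.
by rewrite scalar_mxC -!map_mxM PA.
Qed.

Section Spectral.
Local Open Scope sesquilinear_scope.

(** In an orthonormal eigenbasis over [R[i]] the eigenvalue [mu] is simple, as it exceeds all of
    [s]. So [w] spans its eigenspace, [f] has no component there, and each other component is scaled
    by at most [eps]. *)
Lemma norm_mulmx_orthogonal (R : rcfType) n (M : 'M[R]_n) (w f : 'rV_n)
    (mu eps : R) (s : seq R) :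
  M^T = M -> char_poly M = \prod_(x <- mu :: s) ('X - x%:P) ->
  w != 0 -> w *m M = mu *: w ->
  {in s, forall x, `|x| <= eps} -> eps < mu -> f *m w^T = 0 ->
  \sum_i (f *m M) 0 i ^+ 2 <= eps ^+ 2 * \sum_i f 0 i ^+ 2.
Proof.
move=> Msym Mchar w0 wM s_le mu_gt fw.
pose io : {rmorphism R -> R[i]} := real_complex R; pose Mc := map_mx io M.
have realC x : (io x)^* = io x.
  by apply/CrealP; rewrite realE !(lecR _ 0%R) !(lecR 0%R) -realE num_real.
have conjR m p (B : 'M[R]_(m, p)) : (map_mx io B)^t* = map_mx io B^T.
  by apply/matrixP=> i j; rewrite !mxE realC.
have /orthomx_spectralP : Mc \is normalmx.
  by apply/normalmxP; rewrite conjR Msym.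
set P := spectralmx Mc; set D := spectral_diag Mc => McE.
have Pun : P \is unitarymx by exact: spectral_unitarymx.
have PPt := unitarymxP Pun.
have PtP : P^t* *m P = 1%:M by rewrite mulmx1C.
have Pu := unitarymx_unit Pun.
have PM : P *m Mc = diag_mx D *m P by rewrite {1}McE !mulmxA mulmxV ?mul1mx.
have MP : Mc *m P^t* = P^t* *m diag_mx D.
  by rewrite -[Mc *m _]mul1mx -PtP -!mulmxA (mulmxA P) PM -mulmxA PPt mulmx1.
(* Both products are the characteristic polynomial, so the diagonal is [mu :: s] up to order. *)
have /prod_XsubC_eq Dperm : \prod_(x <- [seq D 0 i | i <- enum 'I_n]) ('X - x%:P)
     = \prod_(x <- io mu :: [seq io x | x <- s]) ('X - x%:P).
  rewrite big_map big_enum -(map_cons io) (big_map io) /=.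
  transitivity (char_poly Mc); last first.
    rewrite -map_char_poly Mchar rmorph_prod; apply: eq_bigr => x _.
    by rewrite rmorphB /= map_polyX map_polyC.
  rewrite (char_poly_similar Pu PM) char_poly_trig; last first.
    by apply/is_trig_mxP => i j ij; rewrite !mxE -val_eqE /= (ltn_eqF ij).
  by apply: eq_bigr => i _; rewrite mxE eqxx.
have Dcase i : (D 0 i == io mu) || (`|D 0 i| <= io eps).
  have : D 0 i \in [seq D 0 i | i <- enum 'I_n] by rewrite map_f ?mem_enum.
  rewrite (perm_mem Dperm) inE => /orP[->//|/mapP[x xs ->]].
  by rewrite [leLHS](_ : _ = io `|x|) ?lecR ?s_le ?orbT // normc_def /= expr0n addr0 sqrtr_sqr.
have muNs : io mu \notin [seq io x | x <- s].
  apply/mapP=> -[x /s_le xs /complexI mux]; move: xs.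
  by rewrite -mux leNgt (lt_le_trans mu_gt) ?ler_norm.
have [i0 Di0 i0P] : exists2 i0, D 0 i0 = io mu & forall i, D 0 i = io mu -> i = i0.
  have : count (pred1 (io mu)) [seq D 0 i | i <- enum 'I_n] = 1%N.
    rewrite (permP Dperm) /= eqxx; congr (1 + _)%N.
    by apply/eqP; rewrite -leqn0 leqNgt -has_count has_pred1.
  rewrite count_map -size_filter; set l := filter _ _.
  have lP i : (i \in l) = (D 0 i == io mu) by rewrite mem_filter mem_enum andbT.
  case: l lP => [|i0 [|]] // lP _; exists i0; first by apply/eqP; rewrite -lP inE.
  by move=> i /eqP; rewrite -lP inE => /eqP.
pose wc := map_mx io w *m P^t*; pose fc := map_mx io f *m P^t*.
have wcD : wc *m diag_mx D = io mu *: wc.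
  by rewrite /wc -mulmxA -MP mulmxA -map_mxM wM map_mxZ scalemxAl.
have wc_i i : i != i0 -> wc 0 i = 0.
  move=> ii0; move/matrixP/(_ 0 i)/eqP: wcD; rewrite mul_mx_diag !mxE mulrC.
  rewrite -subr_eq0 -mulrBl mulf_eq0 subr_eq0 => /orP[/eqP /i0P /eqP|/eqP//].
  by rewrite (negPf ii0).
have wc_n0 : wc 0 i0 != 0.
  apply: contra w0 => /eqP wc0; have: wc = 0.
    by apply/matrixP=> i j; rewrite ord1 [RHS]mxE; case: (eqVneq j i0) => [->|/wc_i].
  move/(congr1 (mulmx^~ P)); rewrite /wc -mulmxA PtP mulmx1 mul0mx.
  by move/eqP; rewrite map_mx_eq0.
have fc_i0 : fc 0 i0 = 0.
  have : fc *m wc^t* = 0.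
    rewrite /fc /wc trmx_mul map_mxM trmxCK mulmxA -(mulmxA (map_mx io f)) PtP mulmx1.
    by rewrite conjR -map_mxM fw map_mx0.
  move/matrixP/(_ 0 0); rewrite mxE (bigD1 i0) //= big1 => [|i ii0]; last first.
    by rewrite !(mxE _ _ i) wc_i // rmorph0 mulr0.
  rewrite addr0 [X in _ * X]mxE [X in X^*]mxE [RHS]mxE => /eqP.
  by rewrite mulf_eq0 conjC_eq0 (negPf wc_n0) orbF => /eqP.
have normE (v : 'rV[R]_n) :
    io (\sum_i v 0 i ^+ 2) = \sum_i `|(map_mx io v *m P^t*) 0 i| ^+ 2.
  transitivity ((map_mx io v *m (map_mx io v)^t*) 0 0).
    rewrite conjR mxE rmorph_sum; apply: eq_bigr => i _.
    by rewrite !mxE rmorphXn /= expr2.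
  transitivity (((map_mx io v *m P^t*) *m (map_mx io v *m P^t*)^t*) 0 0).
    by rewrite trmx_mul map_mxM trmxCK mulmxA -(mulmxA _ _ P) PtP mulmx1.
  by rewrite mxE; apply: eq_bigr => i _; rewrite normCK [X in _ * X = _]mxE [X in X^*]mxE.
rewrite -lecR; change (io (\sum_i (f *m M) 0 i ^+ 2) <= io (eps ^+ 2 * \sum_i f 0 i ^+ 2)).
rewrite rmorphM rmorphXn /= !normE map_mxM -mulmxA MP mulmxA -/fc.
rewrite mulr_sumr; apply: ler_sum => i _; rewrite mul_mx_diag [X in `|X|]mxE.
case: (eqVneq i i0) => [->|ii0]; first by rewrite fc_i0 mul0r normr0 expr0n /= mulr0.
rewrite normrM exprMn mulrC ler_wpM2r ?exprn_ge0 // lerXn2r ?nnegrE //.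
  case/orP: (Dcase i) => [/eqP /i0P /eqP|]; first by rewrite (negPf ii0).
  by move/(le_trans (normr_ge0 _)).
by case/orP: (Dcase i) => [/eqP /i0P /eqP|//]; rewrite (negPf ii0).
Qed.
End Spectral.

Definition spectral_gap (R : realFieldType) (V : finType) (g : rel V) (d : nat) (eps : R) :=
  forall f : V -> R, \sum_v f v = 0 ->
  \sum_v (\sum_u (g v u)%:R * f u) ^+ 2 <= (eps * d%:R) ^+ 2 * \sum_v f v ^+ 2.

(** By regularity the normalized matrix is the adjacency matrix over [d]; the constant vector has
    eigenvalue 1, and zero-sum functions are those orthogonal to it. *)
Lemma expander_spectral_gap (R : realType) (m d : nat) (g : rel 'I_m) (eps : R) :
  eps < 1 -> simple_graph g -> regular g d -> (0 < d)%N ->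
  spectral_expander g eps -> spectral_gap g d eps.
Proof.
move=> eps1 [gsym _] greg d0 [s [[ssz [ssort schar]] ssig]] f f0.
case: (posnP m) => [m0|m0].
  by rewrite !big1 ?mulr0 // => -[i im] _; exfalso; rewrite m0 in im.
have dR0 : d%:R != 0 :> R by rewrite pnatr_eq0 -lt0n.
pose M := normalized_adjacency R g.
have ME i j : M i j = (g i j)%:R / d%:R.
  rewrite !mxE !greg mulrC mulrA -invfM -expr2 sqr_sqrtr ?ler0n //.
  by rewrite mulrC.
have Msym : M^T = M by apply/matrixP=> i j; rewrite mxE !ME gsym.
have degE i : \sum_j (g i j)%:R = d%:R :> R.
  rewrite -(greg i) /degree -sum1_card natr_sum [RHS]big_mkcond /=.
  by apply: eq_bigr => j _; rewrite inE; case: (g i j).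
pose w : 'rV[R]_m := const_mx 1.
have wM : w *m M = 1 *: w.
  apply/matrixP=> i j; rewrite [LHS]mxE !mxE mulr1 -(divff dR0) -{1}(degE j) mulr_suml.
  by apply: eq_bigr => k _; rewrite mxE ME mul1r gsym.
have w0 : w != 0.
  by apply/eqP => /matrixP/(_ 0 (Ordinal m0)); rewrite !mxE => /eqP; rewrite oner_eq0.
have s1 : 1 \in s.
  rewrite -root_prod_XsubC -schar -eigenvalue_root_char.
  by apply/eigenvalueP; exists w.
case: s ssz ssort schar ssig s1 => [|x0 s] // ssz ssort schar ssig s1.
(* [sigma2] bounds the second and the last eigenvalue; sorting extends the bound to those in
   between. As [eps < 1], the eigenvalue 1 must then be the head. *)
have s_le : {in s, forall x, `|x| <= eps}.
  have nthle (i j : nat) : (i <= j)%N -> (j <= size s)%N ->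
      nth 0 (x0 :: s) j <= nth 0 (x0 :: s) i.
    move=> ij js; apply: (sorted_leq_nth (leT := >=%R)) => //; rewrite ?inE //.
    - by move=> a b c /= ab bc; apply: le_trans bc ab.
    - by move=> a /=.
    - by rewrite -[size (x0 :: s)]/(size s).+1 ltnS; exact: leq_trans ij js.
  move=> x /(nthP 0)[i ilt <-]; rewrite ler_norml.
  move: ssig; rewrite /sigma2 ge_max ler_norml => /andP[h1 /andP[h2 _]].
  apply/andP; split; last by apply: le_trans h1; apply: (nthle 1%N i.+1).
  by apply: le_trans h2 _; apply: (nthle i.+1 (size s)).
have x01 : x0 = 1.
  move: s1; rewrite inE => /orP[/eqP//|/s_le]; rewrite normr1 => h.
  by have := le_lt_trans h eps1; rewrite ltxx.
rewrite x01 in schar.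
pose fv := \row_j f j.
have fw : fv *m w^T = 0.
  apply/matrixP=> i j; rewrite !mxE -[RHS]f0; apply: eq_bigr => k _.
  by rewrite !mxE mulr1.
have := norm_mulmx_orthogonal Msym schar w0 wM s_le eps1 fw.
have -> : \sum_i fv 0 i ^+ 2 = \sum_v f v ^+ 2 by apply: eq_bigr => i _; rewrite mxE.
have -> : \sum_i (fv *m M) 0 i ^+ 2
    = (d%:R ^+ 2)^-1 * \sum_v (\sum_u (g v u)%:R * f u) ^+ 2.
  rewrite mulr_sumr; apply: eq_bigr => i _; rewrite mxE -exprVn -exprMn mulr_sumr.
  congr (_ ^+ 2); apply: eq_bigr => j _; rewrite mxE ME gsym; ring.
rewrite ler_pdivrMl ?exprn_gt0 ?ltr0n // => h; apply: le_trans h _.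
by rewrite exprMn mulrA [_ ^+ 2 * _]mulrC.
Qed.

(** Cauchy-Schwarz, obtained from the squared deviations from the mean over [S]. *)
Lemma sqr_sum_le (R : realFieldType) (V : finType) (S : {set V}) (z : V -> R) :
  (\sum_(v in S) z v) ^+ 2 <= #|S|%:R * \sum_v z v ^+ 2.
Proof.
have [->|/set0Pn[v0 v0S]] := eqVneq S set0.
  by rewrite big_set0 expr0n /= cards0 mul0r.
have S0 : 0 < #|S|%:R :> R by rewrite ltr0n card_gt0; apply/set0Pn; exists v0.
set T := \sum_(v in S) z v; pose c := T / #|S|%:R.
apply: (@le_trans _ _ (#|S|%:R * \sum_(v in S) z v ^+ 2)); last first.
  rewrite ler_pM2l // [leRHS](bigID (mem S)) /= lerDl.
  by apply: sumr_ge0 => v _; rewrite sqr_ge0.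
have : 0 <= \sum_(v in S) (z v - c) ^+ 2 by apply: sumr_ge0 => v _; rewrite sqr_ge0.
have -> : \sum_(v in S) (z v - c) ^+ 2
   = \sum_(v in S) z v ^+ 2 - 2 * c * T + c ^+ 2 * #|S|%:R.
  rewrite /T mulr_sumr -sumrB -sum1_card natr_sum mulr_sumr -big_split /=.
  apply: eq_bigr => v _; ring.
have -> : c = T / #|S|%:R by [].
have Sn0 : #|S|%:R != 0 :> R by rewrite gt_eqF.
move: (\sum_(v in S) z v ^+ 2) => Q h.
have := mulr_ge0 (ltW S0) h.
have -> : #|S|%:R * (Q - 2 * (T / #|S|%:R) * T + (T / #|S|%:R) ^+ 2 * #|S|%:R)
    = #|S|%:R * Q - T ^+ 2.
  by field.
by rewrite subr_ge0.
Qed.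

(** * Expander mixing and vertex expansion *)

Section Mixing.
Variables (R : realFieldType) (V : finType) (g : rel V) (d : nat) (eps : R).
Hypotheses (gsym : symmetric g) (d0 : (0 < d)%N).
Hypothesis greg : forall v, #|[set u | g v u]| = d.
Hypotheses (eps0 : 0 <= eps) (gap : spectral_gap g d eps).

Let N : R := #|V|%:R.

Let dev (X : {set V}) v : R := (\sum_(u in X) g v u)%:R - d%:R * #|X|%:R / N.

Lemma sum_nbr (X : {set V}) : (\sum_v \sum_(u in X) g v u = d * #|X|)%N.
Proof.
rewrite exchange_big /= mulnC -sum_nat_const; apply: eq_bigr => u _.
rewrite -(greg u) -sum1_card [RHS]big_mkcond /=; apply: eq_bigr => v _.
by rewrite inE gsym; case: (g _ _).
Qed.

(** The gap is applied to the indicator of [X] minus its mean, which the adjacency operator maps to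
    [dev X]. *)
Lemma dev_le (X : {set V}) : X != set0 ->
  \sum_v dev X v ^+ 2 <= (eps * d%:R) ^+ 2 * (#|X|%:R - #|X|%:R ^+ 2 / N).
Proof.
move=> /set0Pn[v0 v0X].
have N0 : N != 0 by rewrite pnatr_eq0 -lt0n; apply/card_gt0P; exists v0.
pose f v : R := (v \in X)%:R - #|X|%:R / N.
have sumX : \sum_v (v \in X)%:R = #|X|%:R :> R.
  by rewrite -sum1_card natr_sum [RHS]big_mkcond /=; apply: eq_bigr => v _; case: (v \in X).
have sumc (c : R) : \sum_(v : V) c = N * c by rewrite sumr_const mulr_natl.
have f0 : \sum_v f v = 0 by rewrite sumrB sumX sumc mulrC divfK ?subrr.
have fsq : \sum_v f v ^+ 2 = #|X|%:R - #|X|%:R ^+ 2 / N.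
  transitivity (\sum_v ((v \in X)%:R * (1 - 2 * (#|X|%:R / N)) + (#|X|%:R / N) ^+ 2)).
    by apply: eq_bigr => v _; rewrite /f; case: (v \in X); rewrite /=; ring.
  by rewrite big_split /= -mulr_suml sumX sumc; field.
rewrite -fsq; apply: le_trans (gap f0); apply: ler_sum => v _.
rewrite le_eqVlt; apply/orP; left; apply/eqP; congr (_ ^+ 2).
rewrite /dev -(greg v) -sum1_card !natr_sum; under [RHS]eq_bigr do rewrite mulrBr.
rewrite sumrB; congr (_ - _).
  by rewrite [LHS]big_mkcond /=; apply: eq_bigr => u _; case: (u \in X); rewrite ?mulr1 ?mulr0.
rewrite -mulrA mulr_suml [LHS]big_mkcond /=; apply: eq_bigr => u _.
by rewrite inE; case: (g v u); rewrite ?mul0r.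
Qed.

(** The sum of [dev X] over [Y] is the deviation of the edge count from its mean; Cauchy-Schwarz
    bounds it. *)
Lemma edges_ge (X Y : {set V}) : #|X| = #|Y| ->
  d%:R * (#|X|%:R ^+ 2 / N - eps * #|X|%:R) <= (edges g X Y)%:R.
Proof.
move=> XY; have [->|X0] := eqVneq X set0.
  by rewrite cards0 expr0n /= mul0r mulr0 subrr mulr0 ler0n.
have N0 : 0 < N.
  by case/set0Pn: X0 => v0 _; rewrite ltr0n; apply/card_gt0P; exists v0.
have -> : (edges g X Y)%:R = \sum_(v in Y) dev X v + d%:R * #|X|%:R ^+ 2 / N :> R.
  rewrite /dev sumrB sumr_const -XY /edges natr_sum -mulr_natr; ring.
have sq : (\sum_(v in Y) dev X v) ^+ 2 <= (eps * d%:R * #|X|%:R) ^+ 2.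
  apply: le_trans (sqr_sum_le _ _) _; rewrite -XY.
  apply: le_trans (ler_wpM2l (ler0n _ _) (dev_le X0)) _.
  rewrite mulrCA [leRHS]exprMn ler_wpM2l ?sqr_ge0 // [leRHS]expr2 ler_wpM2l //.
  by rewrite gerBl divr_ge0 ?sqr_ge0 // ltW.
have : `|\sum_(v in Y) dev X v| <= eps * d%:R * #|X|%:R.
  by rewrite -ler_sqr ?nnegrE ?mulr_ge0 // real_normK ?num_real.
rewrite ler_norml => /andP[h _]; lra.
Qed.

(** The numbers of neighbours in [X] sum to [d * #|X|] and vanish off [nbrs g X]. Cauchy-Schwarz
    bounds this support from below by the second moment, which [dev_le] controls. *)
Lemma nbrs_ge (X : {set V}) :
  #|X|%:R <= #|nbrs g X|%:R * (#|X|%:R / N + eps ^+ 2).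
Proof.
have [->|X0] := eqVneq X set0.
  by rewrite cards0 mulr_ge0 ?addr_ge0 ?sqr_ge0 ?mul0r.
have N0 : 0 < N.
  by case/set0Pn: X0 => v0 _; rewrite ltr0n; apply/card_gt0P; exists v0.
have x0 : 0 < #|X|%:R :> R by rewrite ltr0n card_gt0.
have dR0 : 0 < d%:R :> R by rewrite ltr0n.
pose z v : R := (\sum_(u in X) g v u)%:R.
have sz : \sum_(v in nbrs g X) z v = d%:R * #|X|%:R.
  rewrite -natrM -sum_nbr natr_sum big_mkcond /=; apply: eq_bigr => v _.
  case: ifP => //; rewrite inE => /existsP nex; rewrite big1 // => u uX.
  by case guv : (g v u) => //; case: nex; exists u; rewrite uX.
have sz2 : \sum_v z v ^+ 2 <= d%:R ^+ 2 * #|X|%:R * (#|X|%:R / N + eps ^+ 2).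
  have -> : \sum_v z v ^+ 2 = \sum_v dev X v ^+ 2 + d%:R ^+ 2 * #|X|%:R ^+ 2 / N.
    have : \sum_v dev X v ^+ 2 = \sum_v z v ^+ 2
        - 2 * (d%:R * #|X|%:R / N) * \sum_v z v + N * (d%:R * #|X|%:R / N) ^+ 2.
      have -> (c : R) : N * c = \sum_(v : V) c by rewrite sumr_const mulr_natl.
      rewrite mulr_sumr -sumrB -big_split /=.
      by apply: eq_bigr => v _; rewrite /dev -/(z v); ring.
    have -> : \sum_v z v = d%:R * #|X|%:R by rewrite -natrM -sum_nbr natr_sum.
    move=> ->; field; lra.
  have := dev_le X0.
  have : 0 <= (eps * d%:R) ^+ 2 * (#|X|%:R ^+ 2 / N).
    by rewrite mulr_ge0 ?sqr_ge0 // divr_ge0 ?sqr_ge0 // ltW.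
  move: (\sum_v dev X v ^+ 2) => S h1 h2.
  have -> : d%:R ^+ 2 * #|X|%:R * (#|X|%:R / N + eps ^+ 2)
      = d%:R ^+ 2 * #|X|%:R ^+ 2 / N + (eps * d%:R) ^+ 2 * #|X|%:R by ring.
  rewrite mulrBr in h2; lra.
have := sqr_sum_le (nbrs g X) z; rewrite sz.
move/le_trans/(_ (ler_wpM2l (ler0n _ _) sz2)) => h.
have p0 : 0 < d%:R ^+ 2 * #|X|%:R :> R by rewrite mulr_gt0 ?exprn_gt0.
rewrite -(ler_pM2l p0).
rewrite (_ : _ * _ = (d%:R * #|X|%:R) ^+ 2); last by ring.
by apply: le_trans h _; rewrite mulrCA.
Qed.
End Mixing.

(** * Counting *)

Section Count.
Variables (R : realType) (V : finType) (g : rel V) (d n : nat) (eps : R).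
Hypotheses (gsym : symmetric g) (girr : irreflexive g) (d0 : (0 < d)%N) (n0 : (0 < n)%N).
Hypotheses (greg : forall v, #|[set u | g v u]| = d) (cardV : #|V| = (2 * n)%N).
Hypotheses (eps0 : 0 < eps) (eps_le : eps <= 11^-1) (gap : spectral_gap g d eps).

Let theta : R := eps * n%:R.
Let t := Num.truncn theta.
Let N s : R := #|matchings g s|%:R.

Let nR0 : 0 < n%:R :> R. Proof. by rewrite ltr0n. Qed.
Let dR0 : 0 < d%:R :> R. Proof. by rewrite ltr0n. Qed.
Let eps0' := ltW eps0.

(** A single vertex spans no edge, so mixing forces [1 / (2 n) <= eps]. This serves the case
    [t = 0]. *)
Lemma theta_ge_half : 2^-1 <= theta.
Proof.
have /card_gt0P[v _] : (0 < #|V|)%N by rewrite cardV; lia.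
have := edges_ge (X := [set v]) (Y := [set v]) greg eps0' gap erefl.
rewrite /edges !big_set1 girr cards1 cardV natrM expr1n mul1r mulr1.
rewrite pmulr_rle0 // subr_le0 invfM /theta.
by rewrite ler_pdivrMr.
Qed.

Lemma t_itv : t%:R <= theta < t%:R + 1.
Proof. by rewrite natr1; apply: truncn_itv; rewrite /theta mulr_ge0 // ltW. Qed.

Lemma t_le_n11 : 11 * t%:R <= n%:R :> R.
Proof.
have /andP[h _] := t_itv; have : theta <= 11^-1 * n%:R by rewrite ler_pM2r.
lra.
Qed.

Lemma t_lt_n : (t < n)%N.
Proof.
by rewrite -(ltr_nat R); have := t_le_n11; have := nR0; have := ler0n R t; lra.
Qed.

(** Fewer than [4 m'] neighbours would give [m < (8/11 + 16/121) m]: the first fraction comes from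
    [m' <= 2 t + 2 <= 4 t] and [11 t <= n], the second from [m' <= 4 m] and [eps <= 1/11]. *)
Lemma nbrs_quad m m' (X : {set V}) : (0 < t)%N ->
  #|X| = m -> (m' <= 4 * m)%N -> (m' <= (2 * t).+2)%N -> (4 * m' <= #|nbrs g X|)%N.
Proof.
move=> t0 Xm m'4 m'T; rewrite leqNgt; apply/negP => K.
case: (posnP m) => [m00|m0]; first by move: K; have -> : m' = 0%N by lia.
have := nbrs_ge gsym d0 greg gap X; rewrite Xm cardV natrM.
set k := #|_| in K *.
have K' : k%:R + 1 <= 4 * m'%:R :> R by rewrite natr1 -natrM ler_nat.
have m'4' : m'%:R <= 4 * m%:R :> R by rewrite -natrM ler_nat.
have m'T' : m'%:R <= 2 * t%:R + 2 :> R by rewrite -natrM -natrD ler_nat addn2.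
have mR0 : 1 <= m%:R :> R by rewrite ler1n.
have tR0 : 1 <= t%:R :> R by rewrite ler1n.
have tn := t_le_n11.
have e2 : eps ^+ 2 <= 121^-1.
  by rewrite (_ : 121^-1 = 11^-1 ^+ 2 :> R) ?lerXn2r ?nnegrE //; [lra|field].
apply/negP; rewrite -ltNge.
set c := _ / _ + _.
have c0 : 0 < c by rewrite ltr_wpDr ?sqr_ge0 // divr_gt0 ?mulr_gt0 //; lra.
apply: (@lt_le_trans _ _ (4 * m'%:R * c)); first by rewrite ltr_pM2r //; lra.
rewrite mulrDr.
have h1 : 4 * m'%:R * (m%:R / (2 * n%:R)) <= 8 / 11 * m%:R :> R.
  rewrite mulrA ler_pdivrMr ?mulr_gt0 //.
  have : m'%:R * m%:R <= 4 * t%:R * m%:R :> R by rewrite ler_pM2r; lra.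
  have : 11 * t%:R * m%:R <= n%:R * m%:R :> R by rewrite ler_pM2r //; lra.
  move: (m%:R : R) (t%:R : R) (n%:R : R) (m'%:R : R) => x y z w; lra.
have h2 : 4 * m'%:R * eps ^+ 2 <= 16 / 121 * m%:R :> R.
  have : 4 * m'%:R * eps ^+ 2 <= 4 * m'%:R * 121^-1.
    by apply: ler_wpM2l => //; rewrite mulr_ge0.
  lra.
lra.
Qed.

(** [2 t + 2] is the least even number above [2 theta], the size at which the mixing bound changes
    sign. *)
Lemma edges_gt0 (X Y : {set V}) : #|X| = (2 * t).+2 -> #|Y| = (2 * t).+2 -> (0 < edges g X Y)%N.
Proof.
move=> XT YT; rewrite -(ltr_nat R).
have XY : #|X| = #|Y| by rewrite XT YT.
apply: lt_le_trans (edges_ge greg eps0' gap XY).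
rewrite XT cardV natrM mulr_gt0 // expr2 -mulrA mulrC -mulrBl mulr_gt0 // subr_gt0.
rewrite ltr_pdivlMr ?mulr_gt0 //.
have /andP[_ h] := t_itv; have -> : (2 * t).+2%:R = 2 * (t%:R + 1) :> R.
  by rewrite -addn2 natrD natrM; ring.
by rewrite mulrCA -/theta ltr_pM2l.
Qed.

(* Extending all matchings that leave [2 j] vertices unmatched multiplies their number by at least
   [beta j * 2 j / (c j * 2 (n - j + 1))]. The middle case of [beta] is [j - 1 <= theta < j], where
   mixing only provides a positive number of edges. *)
Let beta (j : nat) : R :=
  if (j <= t)%N then 2^-1 else if j == t.+1 then (2 * t.+1%:R)^-1
  else d%:R * (j - t.+1)%:R / n%:R.
Let c (j : nat) : R := if (j <= t)%N then d.+1%:R ^+ (depth (2 * t).+2 j).*2 else 1.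

Lemma ends_ratio j : (0 < j <= n)%N ->
  beta j * (2 * j%:R) * N j.*2 <= c j * #|ends g j.*2|%:R.
Proof.
move=> /andP[j0 jn]; rewrite /beta /c /N.
have jR0 : 0 < j%:R :> R by rewrite ltr0n.
case: leqP => jt.
  (* Here [beta j * (2 * j)] is [j], as in [augment_ratio]. *)
  rewrite mulKf ?pnatr_eq0 // mulrC -natrM -natrX -natrM ler_nat.
  apply: (@augment_ratio _ _ gsym girr _ _ _ (2 * t).+2) => //.
  - by rewrite j0 /=; lia.
  - exact: leq_depth.
  - by move=> m m' X; apply: nbrs_quad; lia.
  - exact: edges_gt0.
rewrite mul1r card_ends natr_sum -[N in _ * N]/(#|matchings g j.*2|%:R) mulr_natr -sumr_const.
apply: ler_sum => h; rewrite inE => /andP[_ /eqP hj].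
have /andP[t1 t2] := t_itv.
have := edges_ge greg eps0' gap (erefl #|unmatched h|).
rewrite hj cardV -muln2 !natrM.
have -> : d%:R * ((j%:R * 2) ^+ 2 / (2 * n%:R) - eps * (j%:R * 2))
   = d%:R * 2 * j%:R / n%:R * (j%:R - theta).
  by rewrite /theta; field; rewrite gt_eqF.
move=> E; case: eqP => [jE|jt1].
  rewrite jE mulVf; last by rewrite mulf_neq0 ?pnatr_eq0.
  rewrite ler1n -(ltr_nat R); apply: lt_le_trans E.
  by rewrite mulr_gt0 ?divr_gt0 ?mulr_gt0 // subr_gt0 jE -natr1.
apply: le_trans E; rewrite natrB //.
have -> : d%:R * (j%:R - t.+1%:R) / n%:R * (2 * j%:R)
    = d%:R * 2 * j%:R / n%:R * (j%:R - t.+1%:R) :> R by field; rewrite gt_eqF.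
by rewrite ler_pM2l ?divr_gt0 ?mulr_gt0 // -natr1; lra.
Qed.

Lemma matchings_ratio j : (0 < j <= n)%N ->
  beta j * (2 * j%:R) * N j.*2 <= c j * (2 * (n - j.-1)%:R) * N (j.-1).*2.
Proof.
move=> jn; apply: le_trans (ends_ratio jn) _; rewrite -mulrA ler_wpM2l //.
  by rewrite /c; case: ifP => // _; rewrite exprn_ge0.
rewrite mulrC -!natrM ler_nat.
have := card_ends_le gsym girr (j.-1).*2; rewrite -doubleS prednK; last by case/andP: jn.
by rewrite cardV -!mul2n -mulnBr.
Qed.

Lemma beta_ge0 j : 0 <= beta j.
Proof.
rewrite /beta; case: ifP => _; first by rewrite invr_ge0.
by case: ifP => _; rewrite ?invr_ge0 ?divr_ge0 ?mulr_ge0.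
Qed.

(** The ratios telescope; keeping products on both sides avoids division. *)
Lemma prod_ratio k : (k <= n)%N ->
  \prod_(1 <= j < k.+1) (beta j * (2 * j%:R)) * N k.*2
  <= \prod_(1 <= j < k.+1) (c j * (2 * (n - j.-1)%:R)) * N 0.
Proof.
elim: k => [|k IH] kn; first by rewrite !big_geq.
rewrite !(big_nat_recr k.+1) //= -!mulrA.
have p0 : 0 <= \prod_(1 <= j < k.+1) (beta j * (2 * j%:R)).
  by apply: prodr_ge0 => j _; rewrite mulr_ge0 ?beta_ge0 ?mulr_ge0.
have kn' : (0 < k.+1 <= n)%N by [].
have := ler_wpM2l p0 (matchings_ratio kn'); rewrite -!mulrA => /le_trans; apply.
have c0 : 0 <= c k.+1 * (2 * (n - k)%:R).
  by rewrite !mulr_ge0 // /c; case: ifP => // _; rewrite exprn_ge0.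
have := ler_wpM2l c0 (IH (ltnW kn)).
set P := \prod_(1 <= j < k.+1) _; set Q := \prod_(1 <= j < k.+1) _.
move=> h; rewrite [leLHS](_ : _ = c k.+1 * (2 * (n - k)%:R) * (P * N k.*2)); last first.
  by rewrite /=; ring.
by apply: le_trans h _; rewrite le_eqVlt; apply/orP; left; apply/eqP; ring.
Qed.

Lemma matchings_full : 1 <= N n.*2.
Proof.
rewrite /N ler1n; apply/card_gt0P; exists [ffun v => v]; rewrite inE; apply/andP; split.
  by apply/matchingP; split=> v; rewrite !ffunE ?eqxx.
have -> : unmatched [ffun v : V => v] = [set: V] by apply/setP => v; rewrite !inE ffunE eqxx.
by rewrite cardsT cardV mul2n.
Qed.

Lemma prod_beta_le : \prod_(1 <= j < n.+1) beta j <= \prod_(1 <= j < n.+1) c j * N 0.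
Proof.
have := prod_ratio (leqnn n); rewrite [in leLHS]big_split [in leRHS]big_split /=.
(* The factors [2 (n - j + 1)] are the factors [2 j] in reverse order, so they cancel. *)
have -> : \prod_(1 <= j < n.+1) (2 * (n - j.-1)%:R) = \prod_(1 <= j < n.+1) (2 * j%:R) :> R.
  rewrite [RHS]big_nat_rev /=; apply: eq_big_nat => j /andP[j1 jn].
  by congr (_ * _%:R); lia.
set F := \prod_(1 <= j < n.+1) (2 * j%:R).
have F0 : 0 < F by rewrite /F big_nat prodr_gt0 // => j /andP[j0 _]; rewrite mulr_gt0 ?ltr0n.
set b := \prod_(1 <= j < n.+1) beta j; set c' := \prod_(1 <= j < n.+1) c j.
have b0 : 0 <= b by apply: prodr_ge0 => j _; exact: beta_ge0.
have := ler_wpM2l (mulr_ge0 b0 (ltW F0)) matchings_full; rewrite mulr1 => h1 h2.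
by rewrite -(ler_pM2r F0) [leRHS]mulrAC (le_trans h1 h2).
Qed.

Lemma prod_c_le : \prod_(1 <= j < n.+1) c j <= d.+1%:R ^+ (4 * t).
Proof.
have tn := t_lt_n.
rewrite (big_cat_nat (n := t.+1)) //=; last by rewrite ltnS ltnW.
rewrite [X in _ * X]big1_seq ?mulr1; last first.
  by move=> j /andP[_]; rewrite mem_index_iota => /andP[tj _]; rewrite /c leqNgt tj.
rewrite (eq_big_nat _ _ (F2 := fun j => d.+1%:R ^+ (2 * depth (2 * t).+2 j))); last first.
  by move=> j /andP[_ jt]; rewrite /c -ltnS jt -mul2n.
rewrite prodrXr ler_weXn2l ?ler1n // -big_distrr /=.
by have := sum_depth t; lia.
Qed.

Lemma prod_natr (x : R) k : \prod_(0 <= i < k) (x * i.+1%:R) = x ^+ k * k`!%:R.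
Proof.
elim: k => [|k IH]; first by rewrite big_geq // mulr1.
by rewrite big_nat_recr //= IH exprSr factS natrM; ring.
Qed.

Lemma prod_betaE : \prod_(1 <= j < n.+1) beta j
  = 2^-1 ^+ t * (2 * t.+1%:R)^-1 * ((d%:R / n%:R) ^+ (n - t.+1) * (n - t.+1)`!%:R).
Proof.
have tn := t_lt_n.
rewrite (big_cat_nat (n := t.+1)) //=; last by rewrite ltnS ltnW.
rewrite (eq_big_nat _ _ (F2 := fun=> 2^-1)); last first.
  by move=> j /andP[_ jt]; rewrite /beta -ltnS jt.
rewrite prodr_const_nat subn1 /= -mulrA; congr (_ * _).
rewrite big_ltn ?ltnS //; congr (_ * _); first by rewrite /beta ltnn eqxx.
rewrite -prod_natr -[t.+2]add0n big_addn subSS; apply: eq_big_nat => i _.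
rewrite /beta (_ : (i + t.+2 <= t)%N = false); last by apply/negbTE; lia.
rewrite (_ : (i + t.+2 == t.+1)%N = false); last by apply/negbTE; lia.
by rewrite (_ : (i + t.+2 - t.+1 = i.+1)%N); [rewrite mulrAC|lia].
Qed.

Lemma matchings_ge :
  (d%:R / expR 1) ^+ n / (2 ^+ t * (2 * t.+1%:R) * d%:R ^+ t.+1 * d.+1%:R ^+ (4 * t)) <= N 0.
Proof.
have tn := t_lt_n.
have D0 : 0 < d.+1%:R ^+ (4 * t) :> R by rewrite exprn_gt0.
have := prod_beta_le; rewrite prod_betaE => h.
have {}h := le_trans h (ler_wpM2r (ler0n _ _) prod_c_le).
rewrite -ler_pdivrMl // in h; apply: le_trans h; rewrite [leRHS]mulrC.
set k := (n - t.+1)%N; have nk : n = (k + t.+1)%N by rewrite /k; lia.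
(* A single term of the exponential series gives [n ^ k / k! <= e ^ n], with the full exponent [n]
   although [k < n]. *)
have kfact : expR 1 ^- n <= k`!%:R / n%:R ^+ k :> R.
  have k0 : 0 < k`!%:R :> R by rewrite ltr0n fact_gt0.
  rewrite -[leRHS]invf_div lef_pV2 ?posrE ?exprn_gt0 ?expR_gt0 ?divr_gt0 ?exprn_gt0 //.
  rewrite -expRM_natl mulr1; case: (k) => [|k'].
    by rewrite divr1; apply: le_trans _ (expR_ge1Dx _); rewrite lerDl.
  by apply: le_trans _ (expR_ge1Dxn k' (ltW nR0)); rewrite lerDr.
rewrite invfM [leLHS]mulrA ler_pM2r ?invr_gt0 //.
have -> : (d%:R / expR 1) ^+ n / (2 ^+ t * (2 * t.+1%:R) * d%:R ^+ t.+1)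
   = 2^-1 ^+ t * (2 * t.+1%:R)^-1 * (d%:R ^+ k * expR 1 ^- n) :> R.
  rewrite {1}nk expr_div_n exprD !exprVn -nk; field.
  by rewrite nat1r !expf_neq0 ?pnatr_eq0 ?gt_eqF ?expR_gt0 -?lt0n.
rewrite -!mulrA; apply: ler_wpM2l; first by rewrite exprn_ge0 ?invr_ge0.
apply: ler_wpM2l; first by rewrite invr_ge0 mulr_ge0.
by rewrite expr_div_n -mulrA ler_wpM2l ?exprn_ge0 // mulrC.
Qed.

Lemma defect_le :
  powR (eps / (2 * expR 1 ^+ 3 * d%:R ^+ 6)) theta
    * (2 ^+ t * (2 * t.+1%:R) * d%:R ^+ t.+1 * d.+1%:R ^+ (4 * t)) <= 1.
Proof.
set q := eps / _.
have d1 : 1 <= d%:R :> R by rewrite ler1n.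
have e8 : 8 <= expR 1 ^+ 3 :> R.
  rewrite (_ : 8 = 2 ^+ 3 :> R); last by ring.
  by rewrite lerXn2r ?nnegrE ?expR_ge0 //; have := expR_ge1Dx (1 : R); lra.
have q0 : 0 < q by rewrite divr_gt0 // !mulr_gt0 ?exprn_gt0 ?expR_gt0.
(* [128 / (2 e ^ 3) <= 8] because [e >= 2], and [8 eps <= 1]. *)
have q_le : q * (128 * d%:R ^+ 6) <= 1.
  rewrite /q (_ : _ * _ = 64 * eps / expR 1 ^+ 3); last first.
    by field; rewrite !gt_eqF ?expR_gt0.
  by rewrite ler_pdivrMr ?exprn_gt0 ?expR_gt0 // mul1r; have := eps_le; lra.
have d6 : 1 <= d%:R ^+ 6 :> R by rewrite exprn_ege1.
have q1 : q <= 1.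
  by apply: le_trans q_le; rewrite ler_peMr ?ltW //; lra.
have powq (a : R) : a <= theta -> powR q theta <= powR q a.
  by move=> h; apply: ger_powR; rewrite ?q0.
have /andP[t_le _] := t_itv.
have [t0|t0] := posnP t.
  (* For [t = 0] the defect is [2 d], and [theta >= 1/2] leaves the square root of [q] to absorb
     it. *)
  rewrite t0 expr1 !muln0 !expr0 !mul1r !mulr1.
  apply: le_trans (ler_wpM2r _ (powq _ theta_ge_half)) _; first by rewrite mulr_ge0.
  rewrite powR12_sqrt; last exact: ltW.
  rewrite -(@expr_le1 _ 2) ?mulr_ge0 ?sqrtr_ge0 // exprMn sqr_sqrtr; last exact: ltW.
  apply: le_trans q_le; rewrite ler_pM2l // exprMn.
  have : d%:R ^+ 2 <= d%:R ^+ 6 :> R by rewrite ler_weXn2l.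
  have : 0 <= d%:R ^+ 2 :> R by rewrite sqr_ge0.
  move: (d%:R ^+ 2) (d%:R ^+ 6) => x y; lra.
apply: le_trans (ler_wpM2r _ (powq _ t_le)) _.
  by rewrite !mulr_ge0 ?exprn_ge0.
rewrite powR_mulrn; last exact: ltW.
apply: (@le_trans _ _ (q ^+ t * (128 * d%:R ^+ 6) ^+ t)); last first.
  by rewrite -exprMn exprn_ile1 // (mulr_ge0 (ltW q0)) // mulr_ge0 ?exprn_ge0.
rewrite ler_pM2l ?exprn_gt0 //.
(* The factors of [128 d ^ 6 = 2 * 4 * d ^ 2 * (2 d) ^ 4] dominate the four terms of the defect one
   by one. *)
rewrite (_ : (_ * _) ^+ t
    = 2 ^+ t * 4 ^+ t * (d%:R ^+ (2 * t)) * ((2 * d%:R) ^+ (4 * t))); last first.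
  rewrite !exprM -!exprMn; congr (_ ^+ t); ring.
have le1 : 2 * t.+1%:R <= 4 ^+ t :> R.
  by rewrite -natrM -natrX ler_nat leq_double_exp4.
have le2 : d%:R ^+ t.+1 <= d%:R ^+ (2 * t) :> R.
  by rewrite ler_weXn2l // mul2n -addnn -addn1 leq_add2l.
have le3 : d.+1%:R ^+ (4 * t) <= (2 * d%:R) ^+ (4 * t) :> R.
  by rewrite lerXn2r ?nnegrE ?mulr_ge0 // -natr1; lra.
by rewrite !ler_pM ?mulr_ge0 ?exprn_ge0.
Qed.

Lemma matchings_lower_bound :
  (d%:R / expR 1) ^+ n * powR (eps / (2 * expR 1 ^+ 3 * d%:R ^+ 6)) theta <= N 0.
Proof.
apply: le_trans matchings_ge.
have W0 : 0 < 2 ^+ t * (2 * t.+1%:R) * d%:R ^+ t.+1 * d.+1%:R ^+ (4 * t) :> R.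
  by rewrite !mulr_gt0 ?exprn_gt0.
rewrite ler_pM2l ?exprn_gt0 ?divr_gt0 ?expR_gt0 //.
by rewrite -[leRHS]mul1r ler_pdivlMr // defect_le.
Qed.
End Count.

(** * From involutions to sets of edges, and the theorem *)

(** A fixed-point-free involution [h] is recovered from the pairs [{v, h v}], because exactly one of
    them contains a given [v]. *)
Lemma matchings0_le m (g : rel 'I_m) : (#|matchings g 0| <= num_perfect_matchings g)%N.
Proof.
pose phi (h : {ffun 'I_m -> 'I_m}) := [set [set v; h v] | v in 'I_m].
have edgeE (h : {ffun 'I_m -> 'I_m}) v w : h \in matchings g 0 ->
    v \in [set w; h w] -> [set w; h w] = [set v; h v].
  rewrite inE => /andP[/matchingP[hh _] _]; rewrite !inE => /orP[/eqP->//|/eqP->].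
  by rewrite hh setUC.
have phi_inj : {in matchings g 0 &, injective phi}.
  move=> h h' hM hM' E; apply/ffunP => v.
  have : [set v; h v] \in phi h' by rewrite -E; apply/imsetP; exists v.
  case/imsetP => w _ Ew.
  have : v \in [set w; h' w] by rewrite -Ew !inE eqxx.
  move/(edgeE _ _ _ hM'); rewrite -Ew => /setP/(_ (h v)); rewrite !inE eqxx orbT.
  move/esym/orP => [/eqP hv|/eqP//].
  by move: hM; rewrite inE => /andP[_]; rewrite cards_eq0 => /eqP/setP/(_ v); rewrite !inE hv eqxx.
rewrite -(card_in_imset phi_inj); apply/subset_leq_card/subsetP => _ /imsetP[h hM ->].
have := hM; rewrite inE => /andP[/matchingP[hh hg]]; rewrite cards_eq0 => /eqP/setP h0.
rewrite inE; apply/andP; split.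
  apply/forall_inP => e /imsetP[v _ ->]; apply/existsP; exists v; apply/existsP; exists (h v).
  by rewrite eqxx andbT hg //; have := h0 v; rewrite !inE => ->.
apply/forallP => v; rewrite (_ : finset _ = [set [set v; h v]]) ?cards1 //.
apply/setP => e; rewrite !inE; apply/andP/eqP => [[/imsetP[w _ ->]]|->]; first exact: edgeE.
by split; [apply/imsetP; exists v|rewrite !inE eqxx].
Qed.

Theorem theorem1p4 (R : realType) (eps : R) (n d : nat) (g : rel 'I_(2 * n)) :
  0 < eps -> eps <= 11^-1 ->
  simple_graph g -> regular g d -> spectral_expander g eps ->
  (d%:R / expR 1) ^+ n
    * powR (eps / (2 * expR 1 ^+ 3 * d%:R ^+ 6)) (eps * n%:R)
  <= (num_perfect_matchings g)%:R.
Proof.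
move=> eps0 eps_le gS greg gexp; have [gsym girr] := gS.
case: (posnP n) => [n0|n0].
  (* Without vertices the left side is 1, and the empty set of edges is a perfect matching. *)
  subst n; rewrite mulr0 powRr0 expr0 mulr1 ler1n.
  apply/card_gt0P; exists set0; rewrite inE; apply/andP; split.
    by apply/forall_inP => e; rewrite inE.
  by apply/forallP => -[].
case: (posnP d) => [d0|d0].
  (* For [d = 0] the left side vanishes, since [n > 0]. *)
  by rewrite d0 mul0r expr0n gtn_eqF // mul0r.
have gap : spectral_gap g d eps.
  by apply: (expander_spectral_gap _ gS greg d0 gexp); lra.
have := matchings_lower_bound gsym girr d0 n0 greg (card_ord _) eps0 eps_le gap.
by move/le_trans; apply; rewrite ler_nat matchings0_le.
Qed.
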